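(* Let $A\in \mathbb{R}^{n\times n}$, $p\in [n]$, $\omega=p/n$, and let $L=A\otimes_\omega \overline{D}_p$ and $U=A\otimes_\omega(-\overline{D}_p)^\top$. Then any $(i,j)\in[n]\times[n]$ that satisfies $A(i,j)<L(i,j)$ or $A(i,j)>U(i,j)$ is inactive with respect to $\omega$ and any $x\in E_p(A)$.
   Context: Notation: $[n]=\{1,\dots,n\}$. For $\omega=p/n$, $p\in[n]$, $A\in\mathbb{R}^{n\times n}$ and $x\in\mathbb{R}^n$, the vector $A\otimes_\omega x$ has $i$-th entry equal to the $p$-th smallest element (counted with multiplicity) of the multiset $\{A(i,1)+x_1,\dots,A(i,n)+x_n\}$; for a matrix $B$, $A\otimes_\omega B$ is obtained by applying this to each column of $B$. Thus $L(i,j)$ is the $p$-th smallest of $\{A(i,k)+\overline{D}_p(k,j):k\in[n]\}$ and $U(i,j)$ is the $p$-th smallest of $\{A(i,k)-\overline{D}_p(j,k):k\in[n]\}$. A maxmin-$\omega$ eigenvalue of $A$ is a $\lambda_p\in\mathbb{R}$ such that $A\otimes_\omega x=\lambda_p+x$ (entrywise addition of the scalar) for some $x\in\mathbb{R}^n$; it exists and is unique for each $A$ and $p$. $E_p(A)$ is the set of all $x\in\mathbb{R}^n$ with $A\otimes_\omega x=\lambda_p+x$. An entry $(i,j)$ is called active for $A$ with respect to $x$ and $\omega$ if $(A\otimes_\omega x)_i=A(i,j)+x_j$, and inactive otherwise. For $D\in(\mathbb{R}\cup\{-\infty\})^{n\times n}$ and real row vectors $a,b$ of length $n$, put $$\mathtt{MinMaxValue}(D,a,b\mid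 p,n+1-p)=\min_{S_1,S_2}\ \max_{i\in S_1,\,j\in S_2}\bigl(D(i,j)+a_i-b_j\bigr),$$ where $S_1$ ranges over all $p$-element subsets and $S_2$ over all $(n+1-p)$-element subsets of $[n]$. The sequence $\{D_p^k\}_{k\ge0}$ is defined by $D_p^0=I_n$ (the max-plus identity: zero diagonal, $-\infty$ off the diagonal) and $D_p^{k+1}(i,j)=\mathtt{MinMaxValue}(D_p^k,A_i,A_j\mid p,n+1-p)$ for all $i,j\in[n]$, where $A_i$ denotes the $i$-th row of $A$. The entrywise limit $\overline{D}_p=\lim_{k\to\infty}D_p^k$ exists (the sequence is entrywise nondecreasing and bounded above, with finite entries for $k\ge1$). *)

(* Defs.v *)
From mathcomp Require Import all_boot all_order all_algebra.
From mathcomp Require Import lra.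
From mathcomp Require Import all_classical all_reals all_analysis.

Set Implicit Arguments.
Unset Strict Implicit.
Unset Printing Implicit Defensive.

Import Order.TTheory GRing.Theory Num.Theory.
Import numFieldNormedType.Exports.

Local Open Scope classical_set_scope.
Local Open Scope ring_scope.

(* Ranks are 1-based, with 1 <= p <= size s; repeated entries are kept. *)
Definition pth_smallest (R : realType) (p : nat) (s : seq R) : R :=
  nth 0 (sort <=%R s) p.-1.

(* A (x)_omega B with omega = p / n, for p in {1, ..., n}. As n is the size of
   A, the integer p determines omega and is used as the parameter. A vector x
   of R^n is the case m = 1. *)
Definition maxmin_mul (R : realType) (n m : nat) (p : nat)
    (A : 'M[R]_n) (B : 'M[R]_(n, m)) : 'M[R]_(n, m) :=
  \matrix_(i, j) pth_smallest p [seq A i k + B k j | k <- enum 'I_n].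

Definition maxmin_eigenvalue (R : realType) (n p : nat) (A : 'M[R]_n)
    (lambda : R) : Prop :=
  exists x : 'cV[R]_n, maxmin_mul p A x = const_mx lambda + x.

Lemma pth_smallest_le (R : realType) (p : nat) (s : seq R) (t : R) :
  (1 <= p <= size s)%N ->
  (pth_smallest p s <= t) = (p <= count (<= t) s)%N.
Proof.
case: p => // p /andP[_ ps]; rewrite /pth_smallest /=.
set u := sort <=%R s.
have pu : (p < size u)%N by rewrite size_sort.
have usort : sorted <=%R u by exact: sort_le_sorted.
have mono a b : (a <= b)%N -> (b < size u)%N -> nth 0 u a <= nth 0 u b.
  move=> ab bu; apply: (sorted_leq_nth le_trans le_refl 0 usort) => //.
  exact: leq_ltn_trans ab bu.
have <- : count (<= t) u = count (<= t) s.
  by apply/permP; rewrite perm_sort.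
apply/idP/idP => [ut|].
  rewrite -[X in count _ X](cat_take_drop p.+1 u) count_cat.
  have /eqP -> : count (<= t) (take p.+1 u) == size (take p.+1 u).
    rewrite -all_count; apply/(all_nthP 0) => i; rewrite size_takel // => ip.
    by rewrite nth_take //; apply: le_trans ut; exact: mono.
  by rewrite size_takel // leq_addr.
apply: contraTT; rewrite -ltNge -leqNgt => tu.
rewrite -(cat_take_drop p u) count_cat.
have -> : count (<= t) (drop p u) = 0%N.
  apply/eqP; rewrite -leqn0 leqNgt -has_count; apply/negP => /(has_nthP 0)[i].
  rewrite size_drop nth_drop /= => ip; rewrite leNgt => /negP; apply.
  have pi : (p + i < size u)%N by rewrite -ltn_subRL.
  exact: lt_le_trans tu (mono _ _ (leq_addr _ _) pi).
by rewrite addn0 (leq_trans (count_size _ _)) // size_takel // ltnW.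
Qed.

Lemma maxmin_eigenvalue_unique (R : realType) (n p : nat) (A : 'M[R]_n)
    (lambda mu : R) :
  (1 <= p <= n)%N -> maxmin_eigenvalue p A lambda ->
  maxmin_eigenvalue p A mu -> lambda = mu.
Proof.
move=> hp; suff le l m : maxmin_eigenvalue p A l ->
    maxmin_eigenvalue p A m -> l <= m.
  by move=> hl hm; apply/eqP; rewrite eq_le !le.
move=> [x xl] [y ym].
have n0 : (0 < n)%N by case/andP: hp => /leq_trans; apply.
pose i0 : 'I_n := Ordinal n0.
pose d (k : 'I_n) := x k 0 - y k 0.
have [i _ imax] := @Order.TotalTheory.arg_maxP _ R 'I_n i0 predT d isT.
move/matrixP: xl => /(_ i 0); move/matrixP: ym => /(_ i 0).
rewrite !mxE => ym xl.
suff : l + x i 0 <= m + y i 0 + d i by rewrite /d; lra.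
rewrite -xl pth_smallest_le ?size_map -?enumT ?size_enum_ord //.
have : pth_smallest p [seq A i k + y k 0 | k <- enum 'I_n] <= m + y i 0.
  by rewrite ym.
rewrite pth_smallest_le ?size_map -?enumT ?size_enum_ord // => /leq_trans; apply.
rewrite !count_map; apply: sub_count => k /=.
by have := imax k isT; rewrite /d /=; lra.
Qed.

(* A maxmin-omega eigenvalue is unique, so the existential quantifier
   designates it: see maxmin_eigenvalue_unique. *)
Definition maxmin_eigenspace (R : realType) (n p : nat) (A : 'M[R]_n) :
    set 'cV[R]_n :=
  [set x | exists2 lambda : R, maxmin_eigenvalue p A lambda &
             maxmin_mul p A x = const_mx lambda + x].

Definition active (R : realType) (n p : nat) (A : 'M[R]_n) (x : 'cV[R]_n)
    (i j : 'I_n) : Prop :=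
  maxmin_mul p A x i 0 = A i j + x j 0.

Definition inactive (R : realType) (n p : nat) (A : 'M[R]_n) (x : 'cV[R]_n)
    (i j : 'I_n) : Prop :=
  ~ active p A x i j.

(* MinMaxValue(D, a, b | p, q). The extended reals provide the entry -oo; the
   neutral elements +oo and -oo are never attained as values of an empty
   minimum or maximum when 1 <= p, q <= n. *)
Definition MinMaxValue (R : realType) (n : nat) (D : 'M[\bar R]_n)
    (a b : 'rV[R]_n) (p q : nat) : \bar R :=
  (\big[mine/+oo]_(S : {set 'I_n} * {set 'I_n}
                      | (#|S.1| == p) && (#|S.2| == q))
     \big[maxe/-oo]_(ij : 'I_n * 'I_n | (ij.1 \in S.1) && (ij.2 \in S.2))
        (D ij.1 ij.2 + (a 0%R ij.1)%:E - (b 0%R ij.2)%:E))%E.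

Fixpoint Dseq (R : realType) (n p : nat) (A : 'M[R]_n) (k : nat) :
    'M[\bar R]_n :=
  match k with
  | 0%N => \matrix_(i, j) (if i == j then 0%E else -oo%E)
  | k'.+1 => \matrix_(i, j)
      MinMaxValue (Dseq p A k') (row i A) (row j A) p (n + 1 - p)
  end.

(* The limit is taken in the extended reals, where D_p^0 lives; being finite,
   it is then read as a real number. *)
Definition Dbar (R : realType) (n p : nat) (A : 'M[R]_n) : 'M[R]_n :=
  \matrix_(i, j) fine (limn (fun k => Dseq p A k i j)).

(* Main.v *)
Require Import Defs.
From mathcomp Require Import all_boot all_order all_algebra.
From mathcomp Require Import lra.
From mathcomp Require Import all_classical all_reals all_analysis.

Import Order.TTheory GRing.Theory Num.Theory.
Import numFieldNormedType.Exports.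

Local Open Scope classical_set_scope.
Local Open Scope ring_scope.

(* Let x be an eigenvector with eigenvalue lambda. By induction on m,
   D_p^m(i, j) <= x_i - x_j: in the min-max take S_1 among the k with
   A(i, k) + x_k <= lambda + x_i and S_2 among the l with
   A(j, l) + x_l >= lambda + x_j, which are numerous enough because the p-th
   smallest of these sums is lambda + x_i, respectively lambda + x_j. The
   inequality passes to the limit (which is not -oo, since D_p^1 already is
   finite), so L(i, j) <= lambda + x_i - x_j <= U(i, j). If (i, j) is active,
   the middle term is A(i, j). *)

Lemma exists_subset_card (T : finType) (P : {pred T}) (m : nat) :
  (m <= #|P|)%N -> exists2 S : {set T}, #|S| = m & {subset S <= P}.
Proof.
move=> /card_geqP[s [us sz sP]]; exists [set x in s]%SET.
  by rewrite cardsE (card_uniqP us).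
by move=> x; rewrite inE; exact: sP.
Qed.

Lemma exists_mem_setI (T : finType) (S1 S2 : {set T}) :
  (#|T| < #|S1| + #|S2|)%N -> exists2 k, k \in S1 & k \in S2.
Proof.
move=> lt12; have /card_gt0P[k] : (0 < #|S1 :&: S2|)%N.
  rewrite cardsI subn_gt0; exact: leq_ltn_trans (max_card _) lt12.
by rewrite inE => /andP[k1 k2]; exists k.
Qed.

Lemma pth_smallest_map_le (R : realType) (n p : nat) (f : 'I_n -> R) (t : R) :
  (1 <= p <= n)%N ->
  (pth_smallest p [seq f k | k <- enum 'I_n] <= t)
  = (p <= #|[pred k | (f k <= t)%R]|)%N.
Proof.
move=> hp; rewrite pth_smallest_le ?size_map -?enumT ?size_enum_ord //.
rewrite count_map cardE -size_filter /enum_mem -filter_predI.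
by congr (_ <= size _)%N; apply: eq_filter => k; rewrite /= andbT.
Qed.

Lemma le_pth_smallest (R : realType) (n p : nat) (f g : 'I_n -> R) :
  (1 <= p <= n)%N -> (forall k, f k <= g k) ->
  pth_smallest p [seq f k | k <- enum 'I_n]
  <= pth_smallest p [seq g k | k <- enum 'I_n].
Proof.
move=> hp fg; set t := (X in _ <= X); rewrite pth_smallest_map_le //.
(* Read as a count, the trivial [t <= t] says that at least [p] indices have [g k <= t]; all of them
   satisfy [f k <= t]. *)
have : t <= t by [].
rewrite {1}/t pth_smallest_map_le // => /leq_trans; apply.
apply/subset_leq_card/fintype.subsetP => k; rewrite !inE; exact: le_trans.
Qed.

Lemma pth_smallest_addr (R : realType) (n p : nat) (f : 'I_n -> R) (c : R) :
  (1 <= p <= n)%N ->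
  pth_smallest p [seq f k + c | k <- enum 'I_n]
  = pth_smallest p [seq f k | k <- enum 'I_n] + c.
Proof.
move=> hp; suff le_addr (g : 'I_n -> R) (d : R) :
    pth_smallest p [seq g k + d | k <- enum 'I_n] <=
    pth_smallest p [seq g k | k <- enum 'I_n] + d.
  (* The one-sided bound suffices: the reverse inequality is the same bound for the shift [- c] of
     [f k + c]. *)
  apply/eqP; rewrite eq_le le_addr -lerBrDr.
  apply: (le_trans _ (le_addr _ _)).
  by apply: le_pth_smallest => // k; rewrite addrK.
rewrite pth_smallest_map_le // (eq_card (B := [pred k | g k <=
  pth_smallest p [seq g k | k <- enum 'I_n]])); last first.
  by move=> k; rewrite !inE lerD2r.
by rewrite -pth_smallest_map_le.
Qed.

(** Fewer than [p] values lie strictly below the p-th smallest, so at least [n - (p - 1)] indices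
    remain. *)
Lemma card_ge_pth_smallest (R : realType) (n p : nat) (f : 'I_n -> R) :
  (1 <= p <= n)%N ->
  (n + 1 - p <=
    #|[pred k | (pth_smallest p [seq f l | l <- enum 'I_n] <= f k)%R]|)%N.
Proof.
move=> hp; set t := pth_smallest _ _.
suff lt_p : (#|[pred k | (f k < t)%R]| < p)%N.
  rewrite leq_subLR addn1 -[X in (X < _)%N]card_ord.
  rewrite -(cardC [pred k | (f k < t)%R]) -addSn leq_add //.
  by rewrite eq_leq //; apply: eq_card => k; rewrite !inE leNgt.
have [/card0_eq E0|/card_gt0P[k0]] := posnP #|[pred k | (f k < t)%R]|.
  by rewrite (eq_card0 E0); case/andP: hp.
rewrite inE => k0t.
(* Let [f k] be the largest value below [t]. If [p] values were below [t], all would be at most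
   [f k], forcing [t <= f k]. *)
have [k kt kmax] := @Order.TotalTheory.arg_maxP _ R 'I_n k0
  (fun k => f k < t) f k0t.
rewrite ltnNge; apply/negP => le_p; move: kt; rewrite ltNge => /negP; apply.
rewrite {1}/t pth_smallest_map_le // (leq_trans le_p) //.
by apply/subset_leq_card/fintype.subsetP => l; rewrite !inE; exact: kmax.
Qed.

Lemma MinMaxValue_le (R : realType) (n : nat) (D : 'M[\bar R]_n)
    (a b : 'rV[R]_n) (t : \bar R) (S1 S2 : {set 'I_n}) :
  (forall k l, k \in S1 -> l \in S2 ->
     (D k l + (a 0%R k)%:E - (b 0%R l)%:E <= t)%E) ->
  (MinMaxValue D a b #|S1| #|S2| <= t)%E.
Proof.
move=> le_t; apply: le_trans (bigmin_le_cond _ (j := (S1, S2)) _ _) _.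
  by rewrite /= !eqxx.
apply: bigmax_le; first exact: leNye.
by move=> [k l] /andP[/= kS1 lS2]; exact: le_t.
Qed.

(* Index sets of total size greater than n intersect, so that every maximum
   involves a diagonal entry of D. *)
Lemma MinMaxValue_ge (R : realType) (n p q : nat) (D : 'M[\bar R]_n)
    (a b : 'rV[R]_n) (t : \bar R) :
  (n < p + q)%N ->
  (forall k, (t <= D k k + (a 0%R k)%:E - (b 0%R k)%:E)%E) ->
  (t <= MinMaxValue D a b p q)%E.
Proof.
move=> ltpq ge_t; apply: le_bigmin; first exact: leey.
move=> [S1 S2] /andP[/= /eqP cS1 /eqP cS2].
have [|k kS1 kS2] := @exists_mem_setI _ S1 S2; first by rewrite card_ord cS1 cS2.
apply: le_trans (ge_t k) _.
by apply: (le_bigmax_cond _ (j := (k, k))); rewrite /= kS1 kS2.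
Qed.

Lemma MinMaxValue_mono (R : realType) (n p q : nat) (D1 D2 : 'M[\bar R]_n)
    (a b : 'rV[R]_n) :
  (forall k l, (D1 k l <= D2 k l)%E) ->
  (MinMaxValue D1 a b p q <= MinMaxValue D2 a b p q)%E.
Proof.
move=> le12; apply: le_bigmin2 => S _; apply: le_bigmax2 => kl _.
by rewrite !leeD2r.
Qed.

Lemma ltn_add_rank (n p : nat) : (1 <= p <= n)%N -> (n < p + (n + 1 - p))%N.
Proof. by case/andP=> _ pn; rewrite subnKC ?addn1 // leqW. Qed.

Lemma Dseq_nondecreasing (R : realType) (n p : nat) (A : 'M[R]_n)
    (i j : 'I_n) :
  (1 <= p <= n)%N ->
  {homo (fun k => Dseq p A k i j) : k l / (k <= l)%N >-> (k <= l)%E}.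
Proof.
move=> hp; apply: (@homo_leq _ _ (fun x y : \bar R => (x <= y)%E)) => //.
  exact: le_trans.
move=> k; elim: k i j => [|k IHk] i j.
  (* Only the diagonal matters at the start: there both rows are row [i], so every diagonal term of
     the min-max is 0. *)
  rewrite !mxE; case: eqP => [<-|_]; last exact: leNye.
  apply: MinMaxValue_ge; first exact: ltn_add_rank.
  by move=> k; rewrite !mxE eqxx add0e -EFinB subrr.
by rewrite [X in (X <= _)%E]mxE [X in (_ <= X)%E]mxE; exact: MinMaxValue_mono.
Qed.

Lemma Dseq1_gtNye (R : realType) (n p : nat) (A : 'M[R]_n) (i j : 'I_n) :
  (1 <= p <= n)%N -> (-oo < Dseq p A 1 i j)%E.
Proof.
move=> hp; rewrite mxE.
(* As the diagonal of [D_p^0] is 0, any real lower bound of all [A i k - A j k] works; the initial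
   value 0 can only lower the minimum. *)
apply: (@lt_le_trans _ _ (\big[Order.min/0]_k (A i k - A j k))%:E).
  exact: ltNyr.
apply: MinMaxValue_ge; first exact: ltn_add_rank.
by move=> k; rewrite !mxE eqxx add0e -EFinB lee_fin bigmin_le.
Qed.

Lemma Dseq_le_eigenvector (R : realType) (n p : nat) (A : 'M[R]_n)
    (lambda : R) (x : 'cV[R]_n) (m : nat) (i j : 'I_n) :
  (1 <= p <= n)%N -> maxmin_mul p A x = const_mx lambda + x ->
  (Dseq p A m i j <= (x i 0 - x j 0)%:E)%E.
Proof.
move=> hp xE.
have eigE k : pth_smallest p [seq A k l + x l 0 | l <- enum 'I_n]
    = lambda + x k 0.
  by move/matrixP: xE => /(_ k 0); rewrite !mxE.
elim: m i j => [|m IHm] i j; rewrite mxE.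
  by case: eqP => [->|_]; [rewrite subrr|exact: leNye].
have [|S1 cS1 S1P] := @exists_subset_card _
    [pred k | A i k + x k 0 <= lambda + x i 0] p.
  by rewrite -pth_smallest_map_le // eigE.
have [|S2 cS2 S2P] := @exists_subset_card _
    [pred k | lambda + x j 0 <= A j k + x k 0] (n + 1 - p).
  by rewrite -eigE; exact: card_ge_pth_smallest.
rewrite -[p in MinMaxValue _ _ _ p _]cS1 -cS2.
apply: MinMaxValue_le => k l /S1P + /S2P.
rewrite !inE !mxE => leS1 leS2.
(* By induction the term is at most [(A i k + x_k) - (A j l + x_l)], hence at most
   [(lambda + x_i) - (lambda + x_j)]. *)
rewrite -addeA -EFinB; apply: le_trans (leeD2r _ (IHm k l)) _.
by rewrite -EFinD lee_fin; lra.
Qed.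

Lemma Dbar_le_eigenvector (R : realType) (n p : nat) (A : 'M[R]_n)
    (lambda : R) (x : 'cV[R]_n) (i j : 'I_n) :
  (1 <= p <= n)%N -> maxmin_mul p A x = const_mx lambda + x ->
  Dbar p A i j <= x i 0 - x j 0.
Proof.
move=> hp xE; rewrite mxE.
(* By monotonicity the limit is the supremum of the sequence. *)
have /cvg_lim -> // := @ereal_nondecreasing_cvgn R _
  (Dseq_nondecreasing R n p A i j hp).
set s := ereal_sup _.
have s_le : (s <= (x i 0 - x j 0)%:E)%E.
  by apply: ge_ereal_sup => _ [m _ <-]; exact: Dseq_le_eigenvector xE.
(* Since [fine] sends infinite values to 0, finiteness is needed to transfer the bound. Index 1
   serves because [D_p^0] is [-oo] off the diagonal. *)
have s_gt : (-oo < s)%E.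
  apply: lt_le_trans (Dseq1_gtNye _ _ _ A i j hp) _.
  by apply: ereal_sup_ubound; exists 1%N.
rewrite -lee_fin fineK // fin_real // s_gt.
exact: le_lt_trans s_le (ltry _).
Qed.

Theorem proposition3p19 (R : realType) (n p : nat) (A : 'M[R]_n)
    (hp : (1 <= p <= n)%N) :
  let L := maxmin_mul p A (Dbar p A) in
  let U := maxmin_mul p A ((- Dbar p A)^T) in
  forall i j : 'I_n, A i j < L i j \/ A i j > U i j ->
  forall x : 'cV[R]_n, maxmin_eigenspace p A x -> inactive p A x i j.
Proof.
move=> L U i j AijLU x [lambda _ xE] act.
have Dle k l : Dbar p A k l <= x k 0 - x l 0.
  exact: Dbar_le_eigenvector xE.
(* Activity makes [A i j] a p-th smallest element too, so it can be compared with [L i j] and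
   [U i j] term by term. *)
have AijE : A i j = pth_smallest p [seq A i k + x k 0 - x j 0 | k <- enum 'I_n].
  move: act; rewrite /active mxE => act.
  by rewrite (pth_smallest_addr _ _ _ (fun k => A i k + x k 0)) // act addrK.
case: AijLU; apply/negP; rewrite -leNgt AijE mxE;
  apply: le_pth_smallest => // k; rewrite -addrA lerD2l //.
(* For [U], the bound on the transposed entry [Dbar p A j k] is negated. *)
by rewrite mxE [leRHS]mxE lerNr opprB.
Qed.
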